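(* Let $n\ge 1$, let $A_n=(a_1,\ldots,a_n)$ be a discount sequence (i.e. $a_i\ge 0$ for all $i$ and $\sum_{i=1}^n a_i>0$), and let $\alpha_2$ be a finite nonnull measure on $\mathbf{R}$ with a finite first moment. Let $F$ be a probability distribution on $\mathbf{R}$ with a finite mean. If $0<M<\tilde M$, then $$W(MF,\alpha_2;A_n)\ge W(\tilde M F,\alpha_2;A_n).$$
   Context: All measures are Borel measures on $\mathbf{R}$; a measure $\alpha$ has a finite first moment (finite mean) if $\int |x|\,d\alpha(x)<\infty$. $\delta_x$ is the point mass at $x$. Dirichlet bandit $(\alpha_1,\alpha_2;A_n)$: at each of $n$ stages one of two arms is selected, sequentially, based on past observations. Observations from arm $i$ are independent draws from $P_i$ given $P_i$, where $P_1,P_2$ are independent random probability measures, $P_i$ having a Dirichlet process prior ${\rm DP}(\alpha_i)$, with $\alpha_i$ a finite nonnull measure with finite first moment. The payoff is $\sum_{i=1}^n a_iZ_i$, where $Z_i$ is the observation at stage $i$. $W(\alpha_1,\alpha_2;A_n)$ denotes the maximum expected payoff over all strategies. After observing $x$ from arm $i$, the posterior of $P_i$ is ${\rm DP}(\alpha_i+\delta_x)$. Equivalently, $W$ is given (for all finite sequences of nonnegative reals) by backward induction: $W=0$ for the empty sequence, and for $n\ge1$, with $A_n^1=(a_2,\ldots,a_n)$, $$W(\alpha_1,\alpha_2;A_n)=\max\{W^1(\alpha_1,\alpha_2;A_n),W^2(\alpha_1,\alpha_2;A_n)\},$$ $$W^1(\alpha_1,\alpha_2;A_n)=a_1\mu_1+E[W(\alpha_1+\delta_X,\alpha_2;A_n^1)\,|\,\alpha_1],$$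 $$W^2(\alpha_1,\alpha_2;A_n)=a_1\mu_2+E[W(\alpha_1,\alpha_2+\delta_Y;A_n^1)\,|\,\alpha_2],$$ where $E[g(X)|\alpha]$ means that $X$ has distribution $\alpha/\alpha(\mathbf{R})$, and $\mu_i=\int x\,d\alpha_i(x)/\alpha_i(\mathbf{R})$ is the expected value of an observation from arm $i$. *)

(* Defs.v *)
From HB Require Import structures.
From mathcomp Require Import all_boot all_order all_algebra.
From mathcomp Require Import all_classical all_reals all_analysis.

Set Implicit Arguments.
Unset Strict Implicit.
Unset Printing Implicit Defensive.

Import Order.TTheory GRing.Theory Num.Theory.
Import numFieldNormedType.Exports.

Local Open Scope classical_set_scope.
Local Open Scope ring_scope.

Notation borel_measure R := {measure set (measurableTypeR R) -> \bar R}.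

Definition finite_first_moment (R : realType) (alpha : borel_measure R) : Prop :=
  (\int[alpha]_x (`|x|%R)%:E < +oo)%E.

(* alpha / alpha(R), the law of one observation from an arm with prior
   DP(alpha).  The second argument of mnormalize is the value taken when
   alpha(R) is 0 or +oo; it is irrelevant for finite nonnull alpha. *)
Definition predictive (R : realType) (alpha : borel_measure R) :
  probability (measurableTypeR R) R :=
  mnormalize alpha (dirac (0 : measurableTypeR R)).

(* E[g(X) | alpha].  Finite nonnull measures with a finite first moment are
   stable under adding point masses, and every expectation taken in W for such
   measures is finite, so that fine loses nothing. *)
Definition pred_expect (R : realType) (alpha : borel_measure R)
    (g : measurableTypeR R -> R) : R :=
  fine 'E_(predictive alpha)[g].

Definition arm_mean (R : realType) (alpha : borel_measure R) : R :=
  fine (\int[alpha]_x x%:E)%E / fine (alpha setT).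

(* The parameter alpha + delta_x of the posterior after observing x. *)
Definition posterior (R : realType) (alpha : borel_measure R)
    (x : measurableTypeR R) : borel_measure R :=
  measure_add alpha (dirac x).

(* The maximum expected payoff in the Dirichlet bandit (alpha1, alpha2; A), given
   by backward induction on A: select an arm, discount its observation by the
   first factor, and continue optimally from the posterior of that arm. *)
Fixpoint W (R : realType) (alpha1 alpha2 : borel_measure R) (A : seq R) : R :=
  if A is a :: A1 then
    Num.max
      (a * arm_mean alpha1
         + pred_expect alpha1 (fun x => W (posterior alpha1 x) alpha2 A1))
      (a * arm_mean alpha2
         + pred_expect alpha2 (fun y => W alpha1 (posterior alpha2 y) A1))
  else 0.

Definition discount_sequence (R : realType) (n : nat) (A : n.-tuple R) : Prop :=
  (forall i : 'I_n, 0 <= tnth A i) /\ 0 < \sum_(i < n) tnth A i.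

(* Main.v *)
Require Import Defs.
From HB Require Import structures.
From mathcomp Require Import all_boot all_order all_algebra.
From mathcomp Require Import all_classical all_reals all_analysis.
From mathcomp Require Import measurable_realfun ring lra.
Import Order.TTheory GRing.Theory Num.Theory.
Import numFieldNormedType.Exports.
Local Open Scope classical_set_scope.
Local Open Scope ring_scope.

(** Write [W alpha] for the value as a function of the parameter of the first
    arm, with the second arm and the discounts understood.  The mean of the
    first arm does not depend on its prior weight, but the larger the weight, the
    less an observation changes the predictive law, and the less there is to
    exploit later.  Three inequalities make this precise, each proved by backward
    induction on the discount sequence.

    - [W_midpoint_le]: 2 W(alpha + d_x + d_y) <= W(alpha + 2 d_x) + W(alpha + 2 d_y).
      Along the integer points alpha + j d_x + (k - j) d_y this is convexity of
      [W].  Unrestricted convexity of [W] in the measure fails, but convexity in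
      the directions d_x - d_y survives the recursion, because the next
      observation is x or y with a probability that grows with the
      corresponding weight.

    - [W_add_probability_le]: if G is a probability measure, then
      W(gamma + G) <= E W(gamma + d_X) with X drawn from G.  Replacing the
      spread-out unit of mass G by an actual draw from G keeps the mean on
      average and adds information.  In the induction, the next observation comes
      either from gamma, where the induction hypothesis applies, or from G, and
      then two independent draws X, Z have to be compared with twice the same
      draw, that is E W(gamma + d_X + d_Z) <= E W(gamma + 2 d_X): this is
      [W_midpoint_le] averaged over X and Z.

    - [W_mscale_le]: W(r alpha) <= W(alpha) for r > 1.  The measures r alpha and
      alpha have the same mean, so only the continuations differ.  With m the mass
      of alpha and q = (r m + 1) / (m + 1) > 1 one has
      r alpha + d_x = q (alpha + G_x), where G_x = (r / q - 1) alpha + d_x / q is a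
      probability measure.  The induction hypothesis removes the factor q, the
      previous inequality bounds W(alpha + G_x) by the average of W(alpha + d_Z)
      over Z drawn from G_x, and G_X averages to alpha / m when X is drawn from
      alpha / m.

    The theorem is the case alpha = M F, r = Mt / M.

    The rest is analysis: the integrals in the recursion have to be integrals of
    integrable functions, and their order has to be exchanged.  For this, [W] is
    shown to be measurable along any measurable family of parameters
    ([measurable_W]) and to be bounded by a multiple of the sum of the two
    absolute means ([W_bound]), so that every integrand has linear growth. *)

Section dirichlet_bandit.
Set Implicit Arguments.
Unset Strict Implicit.
Context {R : realType}.
Local Notation T := (measurableTypeR R).
Implicit Types (alpha beta gamma : borel_measure R) (x y z : T) (A : seq R).

(** * Arm parameters and integrals of functions of linear growth *)

Definition mass alpha : R := fine (alpha setT).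

(** The class of parameters on which the recursion is meaningful; it is stable
    under posteriors, sums and positive multiples. *)
Record arm_prior alpha : Prop := ArmPrior {
  arm_prior_lty : (alpha setT < +oo)%E ;
  arm_prior_gt0 : (0 < alpha setT)%E ;
  arm_prior_moment : finite_first_moment alpha }.

Lemma mass_gt0 alpha : arm_prior alpha -> 0 < mass alpha.
Proof. by move=> [h1 h2 _]; rewrite /mass fine_gt0// h2 h1. Qed.

Lemma massE alpha : arm_prior alpha -> alpha setT = (mass alpha)%:E.
Proof. by move=> [h1 h2 _]; rewrite /mass fineK// ge0_fin_numE. Qed.

(** [W] takes measures as structures, so that identities between parameters
    such as the exchangeability of two observations are needed as equalities of
    structures and not only of the underlying set functions. *)
Lemma borel_measure_ext alpha beta :
  (forall U, alpha U = beta U) -> alpha = beta.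
Proof. by move=> h; apply: eq_measure; apply/funext. Qed.

Lemma add_borelE alpha beta U :
  (measure_add alpha beta : borel_measure R) U = (alpha U + beta U)%E.
Proof. exact: measure_addE. Qed.

Lemma mscale_borelE (r : {nonneg R}) alpha U :
  (mscale r alpha : borel_measure R) U = (r%:num%:E * alpha U)%E.
Proof. by []. Qed.

Lemma posteriorE alpha x U : posterior alpha x U = (alpha U + dirac x U)%E.
Proof. exact: measure_addE. Qed.

Lemma posteriorC alpha x y :
  posterior (posterior alpha x) y = posterior (posterior alpha y) x.
Proof.
by apply: borel_measure_ext => U; rewrite !posteriorE addeAC.
Qed.

Lemma posterior_add alpha beta z :
  posterior (measure_add alpha beta) z = measure_add (posterior alpha z) beta.
Proof.
apply: borel_measure_ext => U.
by rewrite !add_borelE addeAC.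
Qed.

(** Linear growth is what a finite first moment makes integrable, and it is
    inherited by all the values of the bandit as functions of the observations. *)
Definition lin_growth (g : T -> R) : Prop :=
  measurable_fun setT g /\ exists c, forall x, `|g x| <= c * (1 + `|x|).

Definition lin_growth2 (f : T * T -> R) : Prop :=
  measurable_fun setT f /\
  exists c, forall p, `|f p| <= c * (1 + `|p.1| + `|p.2|).

Lemma measurable_abs : measurable_fun setT (fun x : T => (`|x|%R)%:E).
Proof. by apply/measurable_EFinP; exact: normr_measurable. Qed.

Lemma integrable_lin alpha (g : T -> R) :
  arm_prior alpha -> lin_growth g -> alpha.-integrable setT (EFin \o g).
Proof.
move=> pa [mg [c hc]].
have i1 : alpha.-integrable setT (cst 1%E).
  apply/integrableP; split; first exact: measurable_cst.
  rewrite (eq_integral (cst 1%E)); last by move=> x _ /=; rewrite normr1.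
  by rewrite integral_cst// mul1e; exact: arm_prior_lty.
have ix : alpha.-integrable setT (fun x : T => (`|x|%R)%:E).
  apply/integrableP; split; first exact: measurable_abs.
  by under eq_integral do rewrite /= normr_id; exact: arm_prior_moment pa.
have : alpha.-integrable setT (fun x : T => c%:E * (1 + (`|x|%R)%:E))%E.
  by apply: integrableZl => //; apply: integrableD.
apply: le_integrable => //; first exact/measurable_EFinP.
move=> x _ /=; rewrite lee_fin; apply: le_trans (hc x) _; exact: ler_norm.
Qed.

Lemma lin_growth_cst c : lin_growth (cst c).
Proof.
split; first exact: measurable_cst.
by exists `|c| => x /=; rewrite ler_peMr// lerDl.
Qed.

Lemma lin_growth_id : lin_growth (fun x => x).
Proof.
split; first exact: measurable_id.
by exists 1 => x /=; rewrite mul1r lerDr.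
Qed.

Lemma lin_growth_norm (g : T -> R) : lin_growth g -> lin_growth (fun x => `|g x|).
Proof.
move=> [mg [c hc]]; split; first exact: measurableT_comp.
by exists c => x; rewrite normr_id.
Qed.

Lemma lin_growthD (f g : T -> R) :
  lin_growth f -> lin_growth g -> lin_growth (fun x => f x + g x).
Proof.
move=> [mf [c hc]] [mg [e he]]; split; first exact: measurable_funD.
by exists (c + e) => x; rewrite mulrDl (le_trans (ler_normD _ _))// lerD.
Qed.

Lemma lin_growthZ c (f : T -> R) :
  lin_growth f -> lin_growth (fun x => c * f x).
Proof.
move=> [mf [e he]]; split; first exact: measurable_funM.
by exists (`|c| * e) => x; rewrite normrM -mulrA ler_wpM2l.
Qed.

Lemma lin_growth2_swap (f : T * T -> R) :
  lin_growth2 f -> lin_growth2 (fun p => f (p.2, p.1)).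
Proof.
move=> [mf [c hc]]; split.
  apply: measurableT_comp => //=.
  by apply/measurable_fun_pairP; split; [exact: measurable_snd|exact: measurable_fst].
by exists c => p; apply: le_trans (hc _) _; rewrite /= addrAC.
Qed.

Lemma lin_growth2l (f : T * T -> R) x :
  lin_growth2 f -> lin_growth (fun y => f (x, y)).
Proof.
move=> [mf [c hc]]; split; first by apply: measurableT_comp => //;
  exact: measurable_pair1.
exists (c * (1 + `|x|)) => y; apply: le_trans (hc _) _ => /=.
have c0 : 0 <= c.
  by have := le_trans (normr_ge0 _) (hc (0, 0)); rewrite /= !normr0 !addr0 mulr1.
rewrite -mulrA ler_wpM2l// mulrDl mul1r mulrDr mulr1.
by rewrite addrACA addrA lerDl mulr_ge0.
Qed.

Lemma RintD alpha (f g : T -> R) : arm_prior alpha -> lin_growth f -> lin_growth g ->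
  \int[alpha]_x (f x + g x) = \int[alpha]_x f x + \int[alpha]_x g x.
Proof. by move=> pa lf lg; rewrite RintegralD//; exact: integrable_lin. Qed.

Lemma RintZ alpha c (f : T -> R) : arm_prior alpha -> lin_growth f ->
  \int[alpha]_x (c * f x) = c * \int[alpha]_x f x.
Proof. by move=> pa lf; rewrite RintegralZl//; exact: integrable_lin. Qed.

Lemma Rint_cst alpha c : \int[alpha]_x c = c * mass alpha.
Proof. exact: Rintegral_cst. Qed.

Lemma Rint_le alpha (f g : T -> R) : arm_prior alpha -> lin_growth f -> lin_growth g ->
  (forall x, f x <= g x) -> \int[alpha]_x f x <= \int[alpha]_x g x.
Proof. by move=> pa lf lg fg; apply: le_Rintegral => //; exact: integrable_lin. Qed.

Lemma Rint_norm alpha (f g : T -> R) : arm_prior alpha -> lin_growth f ->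
  lin_growth g -> (forall x, `|f x| <= g x) ->
  `|\int[alpha]_x f x| <= \int[alpha]_x g x.
Proof.
move=> pa lf lg fg; apply: le_trans (le_normr_Rintegral _ _) _ => //.
  exact: integrable_lin.
by apply: Rint_le => //; exact: lin_growth_norm.
Qed.

Lemma arm_prior_add alpha beta : arm_prior alpha -> arm_prior beta ->
  arm_prior (measure_add alpha beta).
Proof.
move=> [a1 a2 a3] [b1 b2 b3]; split.
- by rewrite add_borelE; exact: lte_add_pinfty.
- by rewrite add_borelE adde_gt0.
- rewrite /finite_first_moment ge0_integral_measure_add//.
    exact: lte_add_pinfty.
  exact: measurable_abs.
Qed.

Lemma Rint_add alpha beta (f : T -> R) :
  arm_prior alpha -> arm_prior beta -> lin_growth f ->
  \int[measure_add alpha beta]_x f x = \int[alpha]_x f x + \int[beta]_x f x.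
Proof.
move=> pa pb lf; rewrite /Rintegral integral_measure_add//.
- by rewrite fineD//; apply: integrable_fin_num => //; exact: integrable_lin.
- exact: integrable_lin.
- exact: integrable_lin.
Qed.

(** Stated for the Dirac mass as a bundled measure, the form in which it enters
    [posterior]. *)
Lemma integral_diracE x (f : T -> \bar R) : measurable_fun setT f ->
  (\int[(dirac x : borel_measure R)]_y f y)%E = f x.
Proof.
move=> mf; apply: (eq_trans (@integral_dirac _ T x R setT measurableT f mf)).
by rewrite diracT mul1e.
Qed.

Lemma dirac_setT x : (dirac x : borel_measure R) setT = 1%E.
Proof. exact: diracT. Qed.

Lemma arm_prior_dirac x : arm_prior (dirac x : borel_measure R).
Proof.
split; first by rewrite dirac_setT ltry.
  by rewrite dirac_setT lte01.
by rewrite /finite_first_moment (integral_diracE x measurable_abs) ltry.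
Qed.

Lemma mass_dirac x : mass (dirac x : borel_measure R) = 1.
Proof. by rewrite /mass dirac_setT. Qed.

Lemma Rint_dirac x (f : T -> R) : lin_growth f ->
  \int[(dirac x : borel_measure R)]_y f y = f x.
Proof.
move=> [mf _]; rewrite /Rintegral integral_diracE//.
exact/measurable_EFinP.
Qed.

Lemma arm_prior_posterior alpha x : arm_prior alpha -> arm_prior (posterior alpha x).
Proof. by move=> pa; apply: arm_prior_add => //; exact: arm_prior_dirac. Qed.

Lemma Rint_posterior alpha x (f : T -> R) : arm_prior alpha -> lin_growth f ->
  \int[posterior alpha x]_y f y = \int[alpha]_y f y + f x.
Proof.
move=> pa lf; rewrite Rint_add// ?Rint_dirac//; exact: arm_prior_dirac.
Qed.

Lemma mass_add alpha beta : arm_prior alpha -> arm_prior beta ->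
  mass (measure_add alpha beta) = mass alpha + mass beta.
Proof.
by move=> pa pb; rewrite /mass add_borelE !massE.
Qed.

Lemma mass_posterior alpha x : arm_prior alpha ->
  mass (posterior alpha x) = mass alpha + 1.
Proof. by move=> pa; rewrite mass_add// ?mass_dirac//; exact: arm_prior_dirac. Qed.

Lemma mass_mscale (r : {nonneg R}) alpha : arm_prior alpha ->
  mass (mscale r alpha) = r%:num * mass alpha.
Proof. by move=> pa; rewrite /mass mscale_borelE massE. Qed.

Lemma Rint_mscale (r : {nonneg R}) alpha (f : T -> R) :
  arm_prior alpha -> lin_growth f ->
  \int[mscale r alpha]_x f x = r%:num * \int[alpha]_x f x.
Proof.
move=> pa lf; have := integrable_lin pa lf => fi.
have mf : measurable_fun setT (EFin \o f) by apply/measurable_EFinP; case: lf.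
rewrite /Rintegral -[in RHS]/(fine r%:num%:E) -fineM//; last exact: integrable_fin_num.
rewrite integralE [in RHS]integralE !ge0_integral_mscale//; last 2 first.
  exact: measurable_funeneg.
  exact: measurable_funepos.
by congr fine; rewrite [in RHS]muleBr//; exact: integrable_add_def.
Qed.

Lemma arm_prior_mscale (r : {nonneg R}) alpha : arm_prior alpha -> 0 < r%:num ->
  arm_prior (mscale r alpha).
Proof.
move=> pa r0; case: (pa) => a1 a2 a3; split.
- by rewrite mscale_borelE massE// -EFinM ltry.
- by rewrite mscale_borelE mule_gt0.
- rewrite /finite_first_moment ge0_integral_mscale//.
    by apply: lte_mul_pinfty => //; rewrite ?lee_fin.
  exact: measurable_abs.
Qed.

(** * Exchange of integrals *)

Definition abs_moment alpha : R := \int[alpha]_x `|x|.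

(** Gives access to the product measures, which are defined only for bundled
    sigma-finite measures; restricting to the whole line bundles the finiteness. *)
Lemma arm_prior_finite_measure alpha : arm_prior alpha ->
  exists m : {finite_measure set T -> \bar R}, alpha = m :> borel_measure R.
Proof.
move=> pa; exists (mfrestr measurableT (arm_prior_lty pa)).
apply: borel_measure_ext => U; rewrite -[in LHS](setIT U).
exact: erefl.
Qed.

Lemma lin_growth_abs : lin_growth (fun x => `|x|).
Proof. exact: lin_growth_norm lin_growth_id. Qed.

Lemma Rint_affine beta a b : arm_prior beta ->
  \int[beta]_y (a + b * `|y|) = a * mass beta + b * abs_moment beta.
Proof.
move=> pb; rewrite RintD// ?RintZ ?Rint_cst//; try exact: lin_growth_abs.
  exact: lin_growth_cst.
exact: lin_growthZ lin_growth_abs.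
Qed.

(** The affine bound on the inner integrals gives both integrability on the
    product and the linear growth of the partial integral. *)
Lemma Rint_norm_section beta (f : T * T -> R) : arm_prior beta -> lin_growth2 f ->
  exists a b, forall x, \int[beta]_y `|f (x, y)| <= a + b * `|x|.
Proof.
move=> pb lf; have [_ [c hc]] := lf.
exists (c * mass beta + c * abs_moment beta), (c * mass beta) => x.
have -> : c * mass beta + c * abs_moment beta + c * mass beta * `|x| =
  c * (1 + `|x|) * mass beta + c * abs_moment beta by ring.
rewrite -Rint_affine//; apply: Rint_le => //.
- exact: lin_growth_norm (lin_growth2l x lf).
- exact: lin_growthD (lin_growth_cst _) (lin_growthZ _ lin_growth_abs).
- by move=> y; rewrite -mulrDr; exact: hc.
Qed.

Lemma integrable_lin2 (m1 m2 : {finite_measure set T -> \bar R})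
    (f : T * T -> R) :
  arm_prior m1 -> arm_prior m2 -> lin_growth2 f ->
  (m1 \x m2)%E.-integrable setT (EFin \o f).
Proof.
move=> p1 p2 lf; have [mf _] := lf.
have mEf : measurable_fun setT (EFin \o f) by exact/measurable_EFinP.
apply/(integrable12ltyP _ _ mEf).
have [a [b hab]] := Rint_norm_section p2 lf.
have i1 : m1.-integrable setT (EFin \o (fun x : T => a + b * `|x|)).
  apply: integrable_lin => //.
  exact: lin_growthD (lin_growth_cst _) (lin_growthZ _ lin_growth_abs).
apply: le_lt_trans (integrable_lty measurableT i1).
have e x : (\int[m2]_y `|(EFin \o f) (x, y)| = (\int[m2]_y `|f (x, y)|)%:E)%E.
  rewrite /Rintegral fineK//; apply: integrable_fin_num => //.
  exact: integrable_lin (lin_growth_norm (lin_growth2l x lf)).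
apply: ge0_le_integral => //.
- by move=> x _; exact: integral_ge0.
- apply: (measurable_fun_fubini_tonelli_F (abse \o (EFin \o f))) => //=.
  exact: measurableT_comp.
- by case/integrableP : i1.
- by move=> x _; rewrite e lee_fin.
Qed.

Lemma Rint_fubini alpha beta (f : T * T -> R) :
  arm_prior alpha -> arm_prior beta -> lin_growth2 f ->
  \int[alpha]_x (\int[beta]_y f (x, y)) = \int[beta]_y (\int[alpha]_x f (x, y)).
Proof.
move=> pa pb lf.
have [m1 e1] := arm_prior_finite_measure pa.
have [m2 e2] := arm_prior_finite_measure pb.
rewrite e1 e2 in pa pb *.
have fi := integrable_lin2 pa pb lf.
have := Fubini fi; rewrite /Rintegral => e.
transitivity (fine (\int[m1]_x \int[m2]_y (EFin \o f) (x, y))%E).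
  congr fine; apply: eq_integral => x _; rewrite fineK//.
  by apply: integrable_fin_num => //; exact: integrable_lin (lin_growth2l x lf).
rewrite e; congr fine; apply: eq_integral => y _; rewrite fineK//.
apply: integrable_fin_num => //.
exact: integrable_lin (lin_growth2l y (lin_growth2_swap lf)).
Qed.

Lemma lin_growth_section beta (f : T * T -> R) : arm_prior beta -> lin_growth2 f ->
  lin_growth (fun x => \int[beta]_y f (x, y)).
Proof.
move=> pb lf; split.
  have [m2 e2] := arm_prior_finite_measure pb.
  rewrite e2 in pb *.
  have := measurable_fubini_F (integrable_lin2 pb pb lf).
  by move=> /(measurableT_comp (fine_measurable measurableT)).
have [a [b hab]] := Rint_norm_section pb lf.
exists (`|a| + `|b|) => x.
have l1 := lin_growth2l x lf.
apply: (@le_trans _ _ (\int[beta]_y `|f (x, y)|)).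
  by apply: le_normr_Rintegral => //; exact: integrable_lin.
apply: le_trans (hab x) _.
have := ler_norm a; have := ler_norm (b * `|x|); rewrite normrM normr_id => h1 h2.
have := mulr_ge0 (normr_ge0 a) (normr_ge0 x).
have := normr_ge0 b.
rewrite mulrDr mulr1 mulrDl; lra.
Qed.

(** * Measurability of the value in the parameters *)

Lemma predictiveE alpha (h : 0 <= (mass alpha)^-1) : arm_prior alpha ->
  predictive alpha = mscale (NngNum h) alpha :> borel_measure R.
Proof.
move=> pa; apply: borel_measure_ext => U.
rewrite mscale_borelE; transitivity (mnormalize alpha (dirac (0 : T)) U) => //.
rewrite /mnormalize.
rewrite (gt_eqF (arm_prior_gt0 pa)) (lt_eqF (arm_prior_lty pa)).
by rewrite /= muleC.
Qed.

Lemma pred_expectE alpha (g : T -> R) : arm_prior alpha -> lin_growth g ->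
  pred_expect alpha g = (\int[alpha]_x g x) / mass alpha.
Proof.
move=> pa lg; have h : 0 <= (mass alpha)^-1 by rewrite invr_ge0 ltW// mass_gt0.
rewrite mulrC -[(mass alpha)^-1]/((NngNum h)%:num) -Rint_mscale//.
by rewrite -predictiveE// /pred_expect unlock.
Qed.

Lemma arm_meanE alpha : arm_prior alpha -> arm_mean alpha = pred_expect alpha id.
Proof. by move=> pa; rewrite pred_expectE//; exact: lin_growth_id. Qed.

Definition measurable_family d (S : measurableType d) (k : S -> borel_measure R) :=
  forall U, measurable U -> measurable_fun setT (fun t => k t U).

(** Normalization turns a kernel into a probability kernel, and integrals of
    nonnegative functions against a finite kernel are measurable in the parameter;
    the positive and negative parts of g are treated separately. *)
Lemma measurable_pred_expect d (S : measurableType d) (k : S -> borel_measure R)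
    (g : S * T -> R) : measurable_family k -> measurable_fun setT g ->
  measurable_fun setT (fun t => pred_expect (k t) (fun x => g (t, x))).
Proof.
move=> mk mg.
pose K : R.-ker S ~> T := HB.pack k (isKernel.Build _ _ S T R k mk).
pose l : R.-pker S ~> T := knormalize K (dirac (0 : T)).
have mE : measurable_fun setT (EFin \o g) by exact/measurable_EFinP.
have m1 : measurable_fun setT (fun t => \int[l t]_x ((EFin \o g)^\+)%E (t, x))%E.
  by apply: measurable_fun_integral_finite_kernel => //; exact: measurable_funepos.
have m2 : measurable_fun setT (fun t => \int[l t]_x ((EFin \o g)^\-)%E (t, x))%E.
  by apply: measurable_fun_integral_finite_kernel => //; exact: measurable_funeneg.
have := measurableT_comp (fine_measurable measurableT) (emeasurable_funB m1 m2).
apply: eq_measurable_fun => t _.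
rewrite /pred_expect [in RHS]expectation.unlock.
have e : l t = predictive (k t) :> borel_measure R by exact: borel_measure_ext.
rewrite [in RHS]integralE -e.
by rewrite !funepos.unlock !funeneg.unlock.
Qed.

Lemma measurable_posterior d (S : measurableType d) (k : S -> borel_measure R)
    (f : S -> T) : measurable_family k -> measurable_fun setT f ->
  measurable_family (fun t => posterior (k t) (f t)).
Proof.
move=> mk mf U mU.
have -> : (fun t => posterior (k t) (f t) U) = (fun t => k t U + kdirac mf t U)%E.
  by apply/funext => t; rewrite posteriorE.
by apply: emeasurable_funD; [exact: mk|exact: measurable_kernel].
Qed.

Lemma measurable_family_comp d d' (S : measurableType d) (S' : measurableType d')
    (k : S -> borel_measure R) (f : S' -> S) : measurable_family k ->
  measurable_fun setT f -> measurable_family (fun t => k (f t)).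
Proof. by move=> mk mf U mU; exact: measurableT_comp (mk U mU) mf. Qed.

(** The family is arbitrary because the recursion enlarges it: after one stage,
    the parameters depend on the previous index and on the new observation, that
    is on a point of S * T. *)
Lemma measurable_W A d (S : measurableType d) (k1 k2 : S -> borel_measure R) :
  measurable_family k1 -> measurable_family k2 ->
  (forall t, arm_prior (k1 t)) -> (forall t, arm_prior (k2 t)) ->
  measurable_fun setT (fun t => W (k1 t) (k2 t) A).
Proof.
elim: A d S k1 k2 => [|a A IH] d S k1 k2 m1 m2 p1 p2 /=; first exact: measurable_cst.
have mean (k : S -> borel_measure R) : measurable_family k ->
    (forall t, arm_prior (k t)) -> measurable_fun setT (fun t => arm_mean (k t)).
  move=> mk pk; under eq_fun do rewrite arm_meanE//.
  exact: (measurable_pred_expect mk (g := snd)).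
have c1 : measurable_family (fun p : S * T => k1 p.1).
  exact: measurable_family_comp.
have c2 : measurable_family (fun p : S * T => k2 p.1).
  exact: measurable_family_comp.
apply: measurable_maxr; apply: measurable_funD.
- by apply: measurable_funM => //; exact: mean.
- apply: (measurable_pred_expect m1
    (g := fun p => W (posterior (k1 p.1) p.2) (k2 p.1) A)).
  apply: IH => //; first exact: measurable_posterior.
  by move=> t; exact: arm_prior_posterior.
- by apply: measurable_funM => //; exact: mean.
- apply: (measurable_pred_expect m2
    (g := fun p => W (k1 p.1) (posterior (k2 p.1) p.2) A)).
  apply: IH => //; first exact: measurable_posterior.
  by move=> t; exact: arm_prior_posterior.
Qed.

(** * Linear growth of the value *)

(** One branch of the maximum in [W], the arm to be pulled listed first; since
    [W] is symmetric in the arms, the same formula gives the other branch. *)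
Definition play a A alpha beta : R :=
  a * arm_mean alpha + pred_expect alpha (fun x => W (posterior alpha x) beta A).

Lemma W_sym A alpha beta : W alpha beta A = W beta alpha A.
Proof.
elim: A alpha beta => [//|a A IH] alpha beta /=; rewrite maxC.
by congr (Num.max (_ + pred_expect _ _) (_ + pred_expect _ _)); apply/funext => x.
Qed.

Lemma W_cons a A alpha beta :
  W alpha beta (a :: A) = Num.max (play a A alpha beta) (play a A beta alpha).
Proof.
rewrite /=; congr (Num.max _ (_ + pred_expect _ _)).
by apply/funext => y; exact: W_sym.
Qed.

Definition mean_abs alpha : R := abs_moment alpha / mass alpha.

Lemma abs_moment_ge0 alpha : 0 <= abs_moment alpha.
Proof. exact: Rintegral_ge0. Qed.

Lemma mean_abs_ge0 alpha : arm_prior alpha -> 0 <= mean_abs alpha.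
Proof. by move=> pa; rewrite divr_ge0 ?abs_moment_ge0// ltW// mass_gt0. Qed.

Lemma mean_abs_posterior alpha x : arm_prior alpha ->
  mean_abs (posterior alpha x) = (abs_moment alpha + `|x|) / (mass alpha + 1).
Proof.
move=> pa; rewrite /mean_abs /abs_moment mass_posterior// Rint_posterior//.
exact: lin_growth_abs.
Qed.

Lemma mean_abs_posterior_le alpha x : arm_prior alpha ->
  mean_abs (posterior alpha x) <= mean_abs alpha + `|x|.
Proof.
move=> pa; rewrite mean_abs_posterior// /mean_abs mulrDl.
have m0 := mass_gt0 pa.
apply: lerD.
  by rewrite ler_wpM2l ?abs_moment_ge0// lef_pV2 ?posrE ?lerDl// addr_gt0.
by rewrite ler_pdivrMr ?addr_gt0// ler_peMr// lerDr ltW.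
Qed.

Lemma measurable_W_posterior A alpha beta : arm_prior alpha -> arm_prior beta ->
  measurable_fun setT (fun x => W (posterior alpha x) beta A).
Proof.
move=> pa pb; apply: measurable_W => //; last by move=> x; exact: arm_prior_posterior.
by apply: (measurable_posterior (k := cst alpha)).
Qed.

(** The absolute mean is a martingale under observation, so that the constant is
    the sum of the absolute discounts. *)
Lemma W_bound A : exists2 s, 0 <= s & forall alpha beta,
  arm_prior alpha -> arm_prior beta ->
  `|W alpha beta A| <= s * (mean_abs alpha + mean_abs beta).
Proof.
elim: A => [|a A [s s0 IH]].
  by exists 0 => // alpha beta _ _ /=; rewrite normr0 mul0r.
exists (`|a| + s); first exact: addr_ge0.
have bplay alpha beta : arm_prior alpha -> arm_prior beta ->
    `|play a A alpha beta| <= (`|a| + s) * (mean_abs alpha + mean_abs beta).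
  move=> pa pb; rewrite /play mulrDl; apply: le_trans (ler_normD _ _) _.
  have m0 := mass_gt0 pa; have m1 : 0 < mass alpha + 1 by exact: addr_gt0.
  apply: lerD.
    rewrite normrM ler_wpM2l// arm_meanE// pred_expectE//; last exact: lin_growth_id.
    apply: (@le_trans _ _ (mean_abs alpha)); last by rewrite lerDl mean_abs_ge0.
    rewrite normrM normfV (gtr0_norm m0) ler_pM2r ?invr_gt0//.
    exact: Rint_norm lin_growth_id lin_growth_abs _.
  pose c := s * (abs_moment alpha / (mass alpha + 1) + mean_abs beta).
  pose e := s / (mass alpha + 1).
  have hb x : `|W (posterior alpha x) beta A| <= c + e * `|x|.
    have -> : c + e * `|x| = s * (mean_abs (posterior alpha x) + mean_abs beta).
      by rewrite mean_abs_posterior// /c /e; ring.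
    by apply: IH => //; exact: arm_prior_posterior.
  have la : lin_growth (fun x => c + e * `|x|).
    exact: lin_growthD (lin_growth_cst _) (lin_growthZ _ lin_growth_abs).
  have lW : lin_growth (fun x => W (posterior alpha x) beta A).
    split; first exact: measurable_W_posterior.
    have [_ [q hq]] := la; exists q => x; apply: le_trans (hb x) _.
    exact: le_trans (ler_norm _) (hq x).
  rewrite pred_expectE// normrM normfV (gtr0_norm m0) ler_pdivrMr//.
  apply: le_trans (Rint_norm pa lW la hb) _.
  rewrite Rint_affine//.
  have -> : c * mass alpha + e * abs_moment alpha =
      s * (mean_abs alpha + mean_abs beta) * mass alpha.
    rewrite /c /e /mean_abs; field.
    by rewrite !gt_eqF// mass_gt0.
  by [].
move=> alpha beta pa pb; rewrite W_cons.
have h1 := bplay _ _ pa pb; have h2 := bplay _ _ pb pa.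
by case: (leP (play a A alpha beta)) => _ //; rewrite [leRHS]mulrC addrC mulrC.
Qed.

Lemma lin_growth_W A alpha beta : arm_prior alpha -> arm_prior beta ->
  lin_growth (fun x => W (posterior alpha x) beta A).
Proof.
move=> pa pb; split; first exact: measurable_W_posterior.
have [s s0 hs] := W_bound A.
exists (s * (1 + mean_abs alpha + mean_abs beta)) => x.
apply: le_trans (hs _ _ (arm_prior_posterior x pa) pb) _.
rewrite -mulrA ler_wpM2l//.
have := mean_abs_posterior_le x pa; have := mean_abs_ge0 pa.
have := mean_abs_ge0 pb; have := normr_ge0 x => x0 b0 a0.
have := mulr_ge0 (addr_ge0 a0 b0) x0.
nra.
Qed.

Lemma lin_growth2_W A alpha beta : arm_prior alpha -> arm_prior beta ->
  lin_growth2 (fun p => W (posterior (posterior alpha p.1) p.2) beta A).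
Proof.
move=> pa pb.
have pax x : arm_prior (posterior alpha x) by exact: arm_prior_posterior.
split.
  apply: measurable_W => //; last by move=> p; exact: arm_prior_posterior.
  apply: (measurable_posterior (k := fun p : T * T => posterior alpha p.1)) => //.
  exact: (measurable_posterior (k := cst alpha)).
have [s s0 hs] := W_bound A.
exists (s * (1 + mean_abs alpha + mean_abs beta)) => -[x y] /=.
apply: le_trans (hs _ _ (arm_prior_posterior y (pax x)) pb) _.
rewrite -mulrA ler_wpM2l//.
have := mean_abs_posterior_le x pa; have := mean_abs_posterior_le y (pax x).
have := mean_abs_ge0 pa.
have := mean_abs_ge0 pb; have := normr_ge0 x; have := normr_ge0 y => y0 x0 b0 a0.
have := mulr_ge0 (addr_ge0 a0 b0) (addr_ge0 x0 y0).
nra.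
Qed.

Lemma lin_growth2_W_arms A alpha beta : arm_prior alpha -> arm_prior beta ->
  lin_growth2 (fun p => W (posterior alpha p.1) (posterior beta p.2) A).
Proof.
move=> pa pb; split.
  apply: measurable_W => //; try by move=> p; exact: arm_prior_posterior.
  - exact: (measurable_posterior (k := cst alpha)).
  - exact: (measurable_posterior (k := cst beta)).
have [s s0 hs] := W_bound A.
exists (s * (1 + mean_abs alpha + mean_abs beta)) => -[x y] /=.
apply: le_trans (hs _ _ (arm_prior_posterior x pa) (arm_prior_posterior y pb)) _.
rewrite -mulrA ler_wpM2l//.
have := mean_abs_posterior_le x pa; have := mean_abs_posterior_le y pb.
have := mean_abs_ge0 pa.
have := mean_abs_ge0 pb; have := normr_ge0 x; have := normr_ge0 y => y0 x0 b0 a0.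
have := mulr_ge0 (addr_ge0 a0 b0) (addr_ge0 x0 y0).
nra.
Qed.

(** * The three inequalities *)

Lemma playE a A alpha beta : arm_prior alpha -> arm_prior beta ->
  play a A alpha beta =
    (a * \int[alpha]_x x + \int[alpha]_x W (posterior alpha x) beta A) / mass alpha.
Proof.
move=> pa pb; rewrite /play arm_meanE// !pred_expectE//; last first.
- exact: lin_growth_id.
- exact: lin_growth_W.
by rewrite mulrA -mulrDl.
Qed.

Lemma le_play_W a A alpha beta : play a A alpha beta <= W alpha beta (a :: A).
Proof. by rewrite W_cons le_max lexx. Qed.

Lemma le_play_W_sym a A alpha beta : play a A beta alpha <= W alpha beta (a :: A).
Proof. by rewrite W_cons le_max lexx orbT. Qed.

(** Put w(uvt) = W(alpha + d_u + d_v + d_t).  When the first arm is pulled, the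
    next observation adds a third atom.  If it comes from alpha, the induction
    hypothesis applies to the enlarged alpha.  If it is x or y, the hypotheses
    with alpha + d_x and alpha + d_y give 2 w(xxy) <= w(xxx) + w(xyy) and
    2 w(xyy) <= w(xxy) + w(yyy), and their sum is
    w(xxy) + w(xyy) <= w(xxx) + w(yyy). *)
Lemma W_midpoint_le A alpha beta x y : arm_prior alpha -> arm_prior beta ->
  2 * W (posterior (posterior alpha x) y) beta A <=
  W (posterior (posterior alpha x) x) beta A + W (posterior (posterior alpha y) y) beta A.
Proof.
elim: A alpha beta x y => [|a A IH] alpha beta x y pa pb; first by rewrite /= mulr0 addr0.
have pp u v : arm_prior (posterior (posterior alpha u) v).
  by do 2 apply: arm_prior_posterior.
have m0 := mass_gt0 (pp x y).
rewrite W_cons maxr_pMr// ge_max; apply/andP; split.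
  apply: le_trans (lerD (le_play_W _ _ _ _) (le_play_W _ _ _ _)).
  pose w u v t := W (posterior (posterior (posterior alpha u) v) t) beta A.
  have mE u v : mass (posterior (posterior alpha u) v) = mass alpha + 2.
    rewrite !mass_posterior//; last exact: arm_prior_posterior.
    by ring.
  have wE u v : play a A (posterior (posterior alpha u) v) beta =
      (a * (\int[alpha]_t t + u + v) + (\int[alpha]_t w u v t + w u v u + w u v v)) /
      (mass alpha + 2).
    rewrite playE// !Rint_posterior//; try exact: arm_prior_posterior.
    - by rewrite mE.
    - exact: lin_growth_W.
    - exact: lin_growth_W.
    - exact: lin_growth_id.
    - exact: lin_growth_id.
  have wC1 u v t : w u v t = w v u t by rewrite /w (posteriorC alpha u v).
  have wC2 u v t : w u v t = w u t v by rewrite /w (posteriorC (posterior alpha u)).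
  have wt u v t : w u v t = W (posterior (posterior (posterior alpha t) u) v) beta A.
    by rewrite [LHS]wC2 [LHS]wC1.
  have lw u v : lin_growth (w u v) by exact: lin_growth_W.
  have conv u v t : 2 * w t u v <= w t u u + w t v v.
    by apply: IH => //; exact: arm_prior_posterior.
  have h0 : 2 * \int[alpha]_t w x y t <= \int[alpha]_t w x x t + \int[alpha]_t w y y t.
    rewrite -RintZ// -RintD//; apply: Rint_le => //.
    - exact: lin_growthZ.
    - exact: lin_growthD.
    - by move=> t; rewrite !wt; apply: IH => //; exact: arm_prior_posterior.
  have h1 := conv x y x.
  have h2 := conv x y y.
  rewrite !wE -!mulrDl mulrA ler_pM2r; last by rewrite invr_gt0 addr_gt0// mass_gt0.
  move: h1 h2; rewrite (wC1 y x y) (wC1 y x x) (wC2 x y x).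
  lra.
apply: le_trans (lerD (le_play_W_sym _ _ _ _) (le_play_W_sym _ _ _ _)).
rewrite !playE// -!mulrDl mulrA ler_pM2r ?invr_gt0 ?mass_gt0//.
have lw u v : lin_growth (fun t =>
    W (posterior beta t) (posterior (posterior alpha u) v) A).
  by exact: lin_growth_W.
have : 2 * \int[beta]_t W (posterior beta t) (posterior (posterior alpha x) y) A <=
  \int[beta]_t W (posterior beta t) (posterior (posterior alpha x) x) A +
  \int[beta]_t W (posterior beta t) (posterior (posterior alpha y) y) A.
  rewrite -RintZ// -RintD//; apply: Rint_le => //.
  - exact: lin_growthZ.
  - exact: lin_growthD.
  - move=> t; rewrite !(W_sym _ (posterior beta t)); apply: IH => //.
    exact: arm_prior_posterior.
lra.
Qed.

Lemma lin_growth_diag (f : T * T -> R) :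
  lin_growth2 f -> lin_growth (fun x => f (x, x)).
Proof.
move=> [mf [c hc]]; split.
  apply: measurableT_comp => //.
  by apply/measurable_fun_pairP; split; exact: measurable_id.
exists (2 * `|c|) => x; apply: le_trans (hc _) _ => /=.
have := ler_wpM2r (normr_ge0 x) (ler_norm c).
have := mulr_ge0 (normr_ge0 c) (normr_ge0 x).
have := ler_norm c; have := normr_ge0 c.
nra.
Qed.

(** Both branches of the maximum at gamma + G are compared with the average over
    X of the same branch at gamma + d_X, which is at most the average of the
    maximum.  The mean payoffs agree, and exchanging the order of integration
    brings the continuations to a form where the induction hypothesis applies. *)
Lemma W_add_probability_le A gamma beta G :
  arm_prior gamma -> arm_prior beta -> arm_prior G ->
  mass G = 1 ->
  W (measure_add gamma G) beta A <= \int[G]_x W (posterior gamma x) beta A.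
Proof.
elim: A gamma beta => [|a A IH] gamma beta pg pb pG G1.
  by rewrite /= Rint_cst mul0r.
have pgG : arm_prior (measure_add gamma G) by exact: arm_prior_add.
have pgx x : arm_prior (posterior gamma x) by exact: arm_prior_posterior.
have m0 := mass_gt0 pg.
have m1 : 0 < mass gamma + 1 by exact: addr_gt0.
rewrite W_cons ge_max; apply/andP; split.
  pose w x t := W (posterior (posterior gamma x) t) beta A.
  have wC x t : w x t = w t x by rewrite /w posteriorC.
  have lw2 : lin_growth2 (fun p => w p.1 p.2) by exact: lin_growth2_W.
  have lw x : lin_growth (w x) by exact: lin_growth_W.
  have lwd : lin_growth (fun x => w x x) by exact: (lin_growth_diag lw2).
  have lwg : lin_growth (fun x => \int[gamma]_t w x t).
    exact: (lin_growth_section pg lw2).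
  have lwG : lin_growth (fun x => \int[G]_t w x t).
    exact: (lin_growth_section pG lw2).
  have pE x : play a A (posterior gamma x) beta =
      (mass gamma + 1)^-1 *
      (a * \int[gamma]_t t + (a * x + (\int[gamma]_t w x t + w x x))).
    rewrite playE// !Rint_posterior//; last 2 first.
    - exact: lw.
    - exact: lin_growth_id.
    by rewrite mass_posterior// [LHS]mulrC; congr (_ * _); rewrite mulrDr -addrA.
  have l1 : lin_growth (fun x => \int[gamma]_t w x t + w x x) by exact: lin_growthD.
  have l2 : lin_growth (fun x => a * x + (\int[gamma]_t w x t + w x x)).
    exact: lin_growthD (lin_growthZ _ lin_growth_id) l1.
  have l3 : lin_growth (fun x => a * \int[gamma]_t t +
      (a * x + (\int[gamma]_t w x t + w x x))).
    exact: lin_growthD (lin_growth_cst _) l2.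
  have lp : lin_growth (fun x => play a A (posterior gamma x) beta).
    by rewrite (funext pE); exact: lin_growthZ.
  apply: (@le_trans _ _ (\int[G]_x play a A (posterior gamma x) beta)); last first.
    apply: Rint_le => //; first exact: lin_growth_W.
    by move=> x; exact: le_play_W.
  rewrite (funext pE) RintZ// RintD//; last exact: lin_growth_cst.
  rewrite RintD//; last exact: (lin_growthZ _ lin_growth_id).
  rewrite (RintZ a pG lin_growth_id).
  rewrite RintD// Rint_cst G1 mulr1 playE// mass_add// G1 mulrC ler_pM2l ?invr_gt0//.
  rewrite Rint_add//; last exact: lin_growth_id.
  rewrite Rint_add//; last exact: lin_growth_W.
  rewrite mulrDr -addrA lerD2l lerD2l.
  have step t : W (posterior (measure_add gamma G) t) beta A <= \int[G]_x w t x.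
    by rewrite posterior_add; exact: IH.
  (* The observation comes from the part gamma. *)
  have h1 : \int[gamma]_t W (posterior (measure_add gamma G) t) beta A <=
      \int[G]_x (\int[gamma]_t w x t).
    apply: (@le_trans _ _ (\int[gamma]_t (\int[G]_x w t x))).
      by apply: Rint_le => //; exact: lin_growth_W.
    rewrite (Rint_fubini pg pG lw2) le_eqVlt; apply/orP; left; apply/eqP.
    by apply: eq_Rintegral => x _; apply: eq_Rintegral => t _; exact: wC.
  apply: lerD => //.
  (* The observation comes from the part G: two independent draws from G against
     the same draw taken twice. *)
  apply: (@le_trans _ _ (\int[G]_t (\int[G]_x w t x))).
    by apply: Rint_le => //; exact: lin_growth_W.
  have ld t : lin_growth (fun x => 2^-1 * w t t + 2^-1 * w x x).
    exact: lin_growthD (lin_growth_cst _) (lin_growthZ _ lwd).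
  have dE t : \int[G]_x (2^-1 * w t t + 2^-1 * w x x) =
      2^-1 * w t t + 2^-1 * \int[G]_x w x x.
    rewrite RintD ?(RintZ 2^-1 pG lwd) ?Rint_cst ?G1 ?mulr1//.
      exact: lin_growth_cst.
    exact: lin_growthZ.
  apply: (@le_trans _ _ (\int[G]_t (2^-1 * w t t + 2^-1 * \int[G]_x w x x))).
    apply: Rint_le => //.
    - exact: lin_growthD (lin_growthZ _ lwd) (lin_growth_cst _).
    - move=> t; rewrite -dE; apply: Rint_le => // x.
      by have := W_midpoint_le A t x pg pb; rewrite -/(w _ _) -!/(w _ _); lra.
  rewrite RintD//; last 2 first.
  - exact: lin_growthZ.
  - exact: lin_growth_cst.
  by rewrite (RintZ 2^-1 pG lwd) Rint_cst G1; lra.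
pose w x y := W (posterior gamma x) (posterior beta y) A.
have lw2 : lin_growth2 (fun p => w p.1 p.2) by exact: lin_growth2_W_arms.
have lwb : lin_growth (fun x => \int[beta]_y w x y).
  exact: (lin_growth_section pb lw2).
have b0 := mass_gt0 pb.
have pE x : play a A beta (posterior gamma x) =
    (mass beta)^-1 * (a * \int[beta]_t t + \int[beta]_y w x y).
  rewrite playE// mulrC; congr (_ * (_ + _)).
  by apply: eq_Rintegral => y _; exact: W_sym.
have l3 : lin_growth (fun x => a * \int[beta]_t t + \int[beta]_y w x y).
  exact: lin_growthD (lin_growth_cst _) lwb.
have lp : lin_growth (fun x => play a A beta (posterior gamma x)).
  by rewrite (funext pE); exact: lin_growthZ.
apply: (@le_trans _ _ (\int[G]_x play a A beta (posterior gamma x))); last first.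
  apply: Rint_le => //; first exact: lin_growth_W.
  by move=> x; exact: le_play_W_sym.
rewrite (funext pE) RintZ// RintD//; last exact: lin_growth_cst.
rewrite Rint_cst G1 mulr1 playE// mulrC ler_pM2l ?invr_gt0// lerD2l.
rewrite (Rint_fubini pG pb lw2); apply: Rint_le => //.
- exact: lin_growth_W.
- exact: (lin_growth_section pG (lin_growth2_swap lw2)).
- move=> y; rewrite W_sym; apply: IH => //; exact: arm_prior_posterior.
Qed.

(** The strict inequality 1 < r makes r / q > 1, so that both summands of G_x
    have positive mass. *)
Lemma W_mscale_le A alpha beta (r : {nonneg R}) : arm_prior alpha -> arm_prior beta ->
  1 < r%:num -> W (mscale r alpha) beta A <= W alpha beta A.
Proof.
elim: A alpha beta r => [//|a A IH] alpha beta r pa pb r1.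
have r0 : 0 < r%:num by exact: lt_trans r1.
have pr : arm_prior (mscale r alpha) by exact: arm_prior_mscale.
have m0 := mass_gt0 pa.
have mm : r%:num * mass alpha != 0 by rewrite mulf_neq0// gt_eqF.
have mn : mass alpha != 0 by rewrite gt_eqF.
have m1 : 0 < mass alpha + 1 by exact: addr_gt0.
rewrite !W_cons ge_max; apply/andP; split; rewrite le_max; apply/orP; [left|right].
  have lW : lin_growth (fun x => W (posterior alpha x) beta A) by exact: lin_growth_W.
  have lWr : lin_growth (fun x => W (posterior (mscale r alpha) x) beta A).
    exact: lin_growth_W.
  rewrite !playE// mass_mscale// !Rint_mscale//; last exact: lin_growth_id.
  set I := \int[alpha]_x W (posterior (mscale r alpha) x) beta A.
  have -> : (a * (r%:num * \int[alpha]_x x) + r%:num * I) / (r%:num * mass alpha) =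
      (a * \int[alpha]_x x + I) / mass alpha.
    by field; rewrite mn gt_eqF.
  rewrite ler_pM2r ?invr_gt0// lerD2l.
  pose q := (r%:num * mass alpha + 1) / (mass alpha + 1).
  have q1 : 1 < q by rewrite /q ltr_pdivlMr// mul1r ltrD2r ltr_pMl.
  have q0 : 0 < q by exact: lt_trans q1.
  have s0 : 0 < r%:num / q - 1.
    by rewrite subr_gt0 ltr_pdivlMr// mul1r /q ltr_pdivrMr// mulrDr mulr1 ltrD2l.
  have t0 : 0 < q^-1 by rewrite invr_gt0.
  pose G x : borel_measure R :=
    measure_add (mscale (NngNum (ltW s0)) alpha) (mscale (NngNum (ltW t0)) (dirac x)).
  pose q' : {nonneg R} := NngNum (ltW q0).
  have GE x : posterior (mscale r alpha) x = mscale q' (measure_add alpha (G x)).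
    apply: borel_measure_ext => U.
    rewrite posteriorE !mscale_borelE !add_borelE !mscale_borelE.
    have a0 : (0 <= alpha U)%E by [].
    have d0 : (0 <= dirac x U)%E by [].
    rewrite ge0_muleDr//; last by rewrite adde_ge0// mule_ge0// lee_fin ltW.
    rewrite ge0_muleDr//; try by rewrite mule_ge0// lee_fin ltW.
    rewrite !muleA addeA -ge0_muleDl ?mule_ge0 ?lee_fin ?ltW//.
    have e1 : q + q * (r%:num / q - 1) = r%:num by field; rewrite gt_eqF.
    have e2 : q * q^-1 = 1 by rewrite divff// gt_eqF.
    rewrite -[RHS]/(((q + q * (r%:num / q - 1))%:E * alpha U +
      (q * q^-1)%:E * dirac x U)%E).
    by rewrite e1 e2 mul1e.
  have pD x : arm_prior (mscale (NngNum (ltW t0)) (dirac x) : borel_measure R).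
    by apply: arm_prior_mscale => //; exact: arm_prior_dirac.
  have pS : arm_prior (mscale (NngNum (ltW s0)) alpha) by exact: arm_prior_mscale.
  have pG x : arm_prior (G x) by exact: arm_prior_add.
  (* The total mass of G_x; also the coefficient of J after averaging over x. *)
  have st : (r%:num / q - 1) * mass alpha + q^-1 = 1.
    by rewrite /q; field; rewrite !gt_eqF// addr_gt0// mulr_gt0.
  have G1 x : mass (G x) = 1.
    rewrite mass_add// !mass_mscale//; last exact: arm_prior_dirac.
    by rewrite mass_dirac mulr1.
  set J := \int[alpha]_x W (posterior alpha x) beta A.
  have step x : W (posterior (mscale r alpha) x) beta A <=
      (r%:num / q - 1) * J + q^-1 * W (posterior alpha x) beta A.
    rewrite GE; apply: le_trans (IH _ _ _ _ pb _) _ => //; first exact: arm_prior_add.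
    apply: le_trans (W_add_probability_le _ pa pb (pG x) (G1 x)) _.
    rewrite Rint_add// !Rint_mscale//; last exact: arm_prior_dirac.
    by rewrite Rint_dirac.
  apply: (@le_trans _ _ (\int[alpha]_x ((r%:num / q - 1) * J +
      q^-1 * W (posterior alpha x) beta A))).
    apply: Rint_le => //.
    exact: lin_growthD (lin_growth_cst _) (lin_growthZ _ lW).
  rewrite RintD ?(RintZ _ pa lW) ?Rint_cst -/J//.
  - by rewrite mulrAC -mulrDl st mul1r.
  - exact: lin_growth_cst.
  - exact: lin_growthZ.
rewrite !playE// ler_pM2r ?invr_gt0 ?mass_gt0// lerD2l.
apply: Rint_le => //; try exact: lin_growth_W.
move=> y; rewrite !(W_sym _ (posterior beta y)); apply: IH => //.
exact: arm_prior_posterior.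
Qed.

End dirichlet_bandit.

Theorem theorem2 (R : realType) (n : nat) (hn : (1 <= n)%N)
  (A : n.-tuple R) (hA : discount_sequence A)
  (alpha2 : {finite_measure set (measurableTypeR R) -> \bar R})
  (halpha2 : (0 < alpha2 setT)%E) (hmoment2 : finite_first_moment alpha2)
  (F : probability (measurableTypeR R) R) (hF : finite_first_moment F)
  (M Mt : R) (hM : 0 < M) (hMt : M < Mt) :
  W (mscale (NngNum (ltW hM)) F) alpha2 A
    >= W (mscale (NngNum (ltW (lt_trans hM hMt))) F) alpha2 A.
Proof.
have p2 : arm_prior alpha2.
  by split=> //; rewrite -ge0_fin_numE// fin_num_measure.
have pF : arm_prior F.
  have F1 : (F : borel_measure R) setT = 1%E by exact: probability_setT.
  by split; rewrite ?F1 ?ltry ?lte01.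
have pMF : arm_prior (mscale (NngNum (ltW hM)) F) by exact: arm_prior_mscale.
have r0 : 0 < Mt / M by rewrite divr_gt0// (lt_trans hM).
have -> : mscale (NngNum (ltW (lt_trans hM hMt))) F =
    mscale (NngNum (ltW r0)) (mscale (NngNum (ltW hM)) F) :> borel_measure R.
  apply: borel_measure_ext => U; rewrite !mscale_borelE muleA -EFinM /=.
  by rewrite divfK// gt_eqF.
by apply: W_mscale_le => //=; rewrite ltr_pdivlMr// mul1r.
Qed.
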